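(* Let $R$ be a commutative ring, $L$ a finite meet semilattice with zeta function $\zeta$ and Möbius function $\mu$, and $X=\{x_1,\dots,x_n\}\subseteq L$. Let $\overline X=\{x_1,\dots,x_n,x_{n+1},\dots,x_{n+m}\}$ be the smallest factor-closed subset of $L$ containing $X$. For each $x\in X$ fix $z_x\in\overline X$ with $z_x\le x$ and a function $F_x:L\to R$, and put $f_x(y)=\sum_{w\le y}\mu(w,y)F_x(w)$. Let $k\ge2$ and $\mathcal F:\mathfrak S_n^{k-2}\to R$ any map, and let \[ DF(X)=\mathrm{Det}_{\mathcal F}\Big(F_{x_{i_1}}(z_{x_{i_1}}\wedge x_{i_2}\wedge\cdots\wedge x_{i_k})\Big)_{1\le i_1,\dots,i_k\le n}. \] Then \[ DF(X)=\sum_{1\le k_1<\cdots<k_n\le n+m}\mathrm{Det}_{\mathcal F}\Big(f_{x_{i_1}}(x_{k_{i_2}})\,\zeta\big(x_{k_{i_2}},z_{x_{i_1}}\wedge x_{i_3}\wedge\cdots\wedge x_{i_k}\big)\Big)_{1\le i_1,\dots,i_k\le n}\cdot\det\big(\zeta(x_{k_i},x_j)\big)_{1\le i,j\le n}. \]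
   Context: A meet semilattice is a poset in which every pair $x,y$ has a greatest lower bound $x\wedge y$. $\zeta(x,y)=1$ if $x\le y$ and $0$ otherwise; the Möbius function is $\mu(x,x)=1$, $\mu(x,y)=-\sum_{x\le z<y}\mu(z,y)$ if $x<y$, and $0$ otherwise. A subset $S\subseteq L$ is factor-closed if $y\in S$ and $x\le y$ imply $x\in S$. $\mathfrak S_n$ is the symmetric group on $\{1,\dots,n\}$. For $\mathcal F:\mathfrak S_n^{k-2}\to R$ and a hypermatrix $M=(M_{i_1,\dots,i_k})_{1\le i_j\le n}$, the $\mathcal F$-determinant is $\mathrm{Det}_{\mathcal F}(M)=\sum_{(\sigma_2,\dots,\sigma_k)\in\mathfrak S_n^{k-1}}\mathrm{sign}(\sigma_2)\mathcal F(\sigma_3,\dots,\sigma_k)\prod_{i=1}^n M_{i,\sigma_2(i),\dots,\sigma_k(i)}$. (In a hypermatrix with entries written in terms of $i_1,\dots,i_k$, the entry shown is the $(i_1,\dots,i_k)$ entry.)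
   Formalization: The Möbius function is taken with its standard recursion μ(x,y) = −Σ_{x≤z<y} μ(x,z) for x<y; the source's printed formula, with μ(z,y) in the sum over x≤z<y, is circular and would make the identity fail on a two-element chain. *)

(* Defs.v *)
From HB Require Import structures.
From mathcomp Require Import all_boot all_order all_fingroup all_algebra.

Set Implicit Arguments.
Unset Strict Implicit.
Unset Printing Implicit Defensive.

Import Order.TTheory GRing.Theory.
Local Open Scope ring_scope.

Definition factor_closed (d : Order.disp_t) (L : finPOrderType d)
    (S : {set L}) : Prop :=
  forall x y : L, y \in S -> (x <= y)%O -> x \in S.

Definition smallest_factor_closed (d : Order.disp_t) (L : finPOrderType d)
    (X S : {set L}) : Prop :=
  [/\ factor_closed S, X \subset S
    & forall T : {set L}, factor_closed T -> X \subset T -> S \subset T].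

(* The zeta and Moebius functions are integer-valued; they are taken here with
   values in the coefficient ring R, through the canonical map from the
   integers to R. *)
Definition zeta (R : pzRingType) (d : Order.disp_t) (L : finPOrderType d)
    (x y : L) : R := ((x <= y)%O)%:R.

(* The first argument of mobius_rec bounds the recursion depth; the bound #|L|
   used in mobius is never reached, see mobiusE. *)
Fixpoint mobius_rec (R : pzRingType) (d : Order.disp_t) (L : finPOrderType d)
    (fuel : nat) (x y : L) : R :=
  if fuel is fuel'.+1 then
    if x == y then 1
    else if (x < y)%O
    then - \sum_(z : L | (x <= z)%O && (z < y)%O) mobius_rec R fuel' x z
    else 0
  else 0.

Definition mobius (R : pzRingType) (d : Order.disp_t) (L : finPOrderType d)
    (x y : L) : R := mobius_rec R #|L| x y.

Arguments zeta R {d L} x y.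
Arguments mobius R {d L} x y.

Lemma mobius_rec_fuel (R : pzRingType) (d : Order.disp_t)
    (L : finPOrderType d) (a b : nat) (x y : L) :
  (#|[set t : L | (t <= y)%O]| <= a)%N ->
  (#|[set t : L | (t <= y)%O]| <= b)%N ->
  mobius_rec R a x y = mobius_rec R b x y.
Proof.
elim: a b y => [|a IHa] b y.
  by rewrite leqn0 cards_eq0 => /eqP/setP/(_ y); rewrite !inE lexx.
case: b => [_|b].
  by rewrite leqn0 cards_eq0 => /eqP/setP/(_ y); rewrite !inE lexx.
move=> leya leyb /=; case: eqP => // _; case: ifP => // _; congr (- _).
apply: eq_bigr => z /andP[_ ltzy].
have ltc : (#|[set t : L | (t <= z)%O]| < #|[set t : L | (t <= y)%O]|)%N.
  apply: proper_card; apply/properP; split.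
    by apply/subsetP => t; rewrite !inE => /le_trans; apply; apply: ltW.
  by exists y; rewrite !inE ?lexx // lt_geF.
by apply: IHa; rewrite -ltnS; apply: leq_trans ltc _.
Qed.

Lemma mobiusE (R : pzRingType) (d : Order.disp_t) (L : finPOrderType d)
    (x y : L) :
  mobius R x y =
    if x == y then 1
    else if (x < y)%O
    then - \sum_(z : L | (x <= z)%O && (z < y)%O) mobius R x z
    else 0.
Proof.
have fuelP (z : L) : (#|[set t : L | (t <= z)%O]| <= #|L|)%N by exact: max_card.
rewrite /mobius (@mobius_rec_fuel _ _ _ #|L| #|L|.+1) ?(leqW (fuelP _)) //.
Qed.

(* A hypermatrix of order k and size n is a function of its first index i_1,
   its second index i_2 and the family (i_3, ..., i_k) of the k - 2 remaining
   ones; likewise sigma is sigma_2 and s is (sigma_3, ..., sigma_k). *)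
Definition hyperdet (R : pzRingType) (n k : nat)
    (FF : {ffun 'I_(k - 2) -> 'S_n} -> R)
    (M : 'I_n -> 'I_n -> {ffun 'I_(k - 2) -> 'I_n} -> R) : R :=
  \sum_(sigma : 'S_n) \sum_(s : {ffun 'I_(k - 2) -> 'S_n})
    (-1) ^+ sigma * FF s *
    \prod_(i < n) M i (sigma i) [ffun j => s j i].

(* A meet semilattice need not have a top element, so the big meets below are
   started from a.  With u_3, ..., u_k for the k - 2 values of u, bigmeet a u
   is a /\ u_3 /\ ... /\ u_k; for an empty family it is a. *)
Definition bigmeet (d : Order.disp_t) (L : finMeetSemilatticeType d) (q : nat)
    (a : L) (u : 'I_q -> L) : L :=
  \big[Order.meet/a]_(j < q) u j.

(* Main.v *)
(* By Moebius inversion F_x(v) is the sum of f_x(y) over y <= v.  As Xbar is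
   factor-closed, every y <= z_x /\ x_{i_2} /\ ... /\ x_{i_k} is some x_l, so
   once (i_3, ..., i_k) are expressed through i_1 and fixed permutations
   sigma_3, ..., sigma_k, the hypermatrix becomes a product of an n x (n + m)
   matrix by the (n + m) x n matrix zeta(x_l, x_{i_2}).  The Cauchy-Binet
   formula applies to each such product. *)
Require Import Defs.
From HB Require Import structures.
From mathcomp Require Import all_boot all_order all_fingroup all_algebra.

Set Implicit Arguments.
Unset Strict Implicit.
Unset Printing Implicit Defensive.

Import Order.TTheory GRing.Theory.
Local Open Scope ring_scope.

Lemma le_bigmeet (d : Order.disp_t) (L : finMeetSemilatticeType d) (q : nat)
    (a : L) (u : 'I_q -> L) (y : L) :
  (y <= bigmeet a u)%O = (y <= a)%O && [forall j, (y <= u j)%O].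
Proof.
transitivity ((y <= a)%O && \big[andb/true]_(j < q) (y <= u j)%O); last first.
  by rewrite big_andE.
rewrite /bigmeet; elim: q u => [|q IHq] u; first by rewrite !big_ord0 andbT.
by rewrite !big_ord_recl lexI IHq andbCA.
Qed.

(** Separates x_{i_2} from the other arguments of the meet, so that the indicator of [y] lying below
    the whole meet splits into two zeta factors. *)
Lemma le_bigmeetI (d : Order.disp_t) (L : finMeetSemilatticeType d) (q : nat)
    (a b : L) (u : 'I_q -> L) (y : L) :
  (y <= bigmeet (a `&` b) u)%O = (y <= bigmeet a u)%O && (y <= b)%O.
Proof. by rewrite !le_bigmeet lexI -!andbA; congr (_ && _); rewrite andbC. Qed.

(** For [w < v] the recursion [mobiusE] makes the term [y = v] cancel all the others. *)
Lemma sum_mobius (R : pzRingType) (d : Order.disp_t) (L : finPOrderType d)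
    (w v : L) : (w <= v)%O ->
  \sum_(y : L | (w <= y)%O && (y <= v)%O) mobius R w y = (w == v)%:R.
Proof.
move=> le_wv; rewrite (bigD1 v) /= ?le_wv ?lexx // mobiusE.
have [->|neq_wv] := eqVneq w v.
  rewrite big1 ?addr0 // => y /andP[/andP[le_vy le_yv] /eqP[]].
  by apply: le_anti; rewrite le_vy le_yv.
rewrite lt_neqAle neq_wv le_wv /= addrC; apply/eqP; rewrite subr_eq0; apply/eqP.
by apply: eq_bigl => y; rewrite -andbA lt_neqAle [(y != v) && _]andbC.
Qed.

Lemma mobius_inversion (R : pzRingType) (d : Order.disp_t)
    (L : finPOrderType d) (F : L -> R) (v : L) :
  \sum_(y : L | (y <= v)%O) \sum_(w : L | (w <= y)%O) mobius R w y * F w = F v.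
Proof.
(* After the exchange, the coefficient of [F w] is the Moebius sum over the interval from [w] to
   [v], so only [w = v] survives. *)
rewrite (exchange_big_dep (fun w => (w <= v)%O)) /=; last first.
  by move=> y w le_yv le_wy; apply: le_trans le_yv.
rewrite (bigD1 v) ?lexx //= [X in _ + X]big1 ?addr0 => [|w /andP[le_wv neq_wv]];
  rewrite -mulr_suml (eq_bigl _ _ (fun y => andbC _ _)) sum_mobius //.
  by rewrite eqxx mul1r.
by rewrite (negPf neq_wv) mul0r.
Qed.

(** Expanding the product of row sums chooses an inner index [f i] for each row [i]; the signed sum
    over permutations then reassembles a determinant of rows of [B]. *)
Lemma det_mulmx_sum (R : comPzRingType) (n p : nat)
    (A : 'M[R]_(n, p)) (B : 'M[R]_(p, n)) :
  \det (A *m B) =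
    \sum_(f : {ffun 'I_n -> 'I_p}) \prod_i A i (f i) * \det (rowsub f B).
Proof.
transitivity (\sum_(s : 'S_n) \sum_(f : {ffun 'I_n -> 'I_p})
    (-1) ^+ s * \prod_i (A i (f i) * B (f i) (s i))).
  apply: eq_bigr => s _; rewrite -big_distrr /=; congr (_ * _).
  rewrite -(bigA_distr_bigA (fun i l => A i l * B l (s i))) /=.
  by apply: eq_bigr => i _; rewrite mxE.
rewrite exchange_big; apply: eq_bigr => f _; rewrite big_distrr /=.
apply: eq_bigr => s _; rewrite big_split mulrCA /=; congr (_ * (_ * _)).
by apply: eq_bigr => i _; rewrite mxE.
Qed.

(** Encodes a choice of indices k_1 < ... < k_n. *)
Definition increasing_ffun (n p : nat) (g : {ffun 'I_n -> 'I_p}) : bool :=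
  [forall i : 'I_n, forall j : 'I_n, (i < j)%N ==> (g i < g j)%N].

Definition is_rank (n p : nat) (f : {ffun 'I_n -> 'I_p}) (s : 'S_n) : bool :=
  [forall i, s i == #|[set j | (f j < f i)%N]| :> nat].

Lemma is_rank_comp (n p : nat) (g : {ffun 'I_n -> 'I_p}) (s : 'S_n) :
  is_rank [ffun i => g (s i)] s = increasing_ffun g.
Proof.
have card_s i : #|[set j | ([ffun k => g (s k)] j < [ffun k => g (s k)] i)%N]|
    = #|[set b | (g b < g (s i))%N]|.
  rewrite -[RHS](card_preimset _ (@perm_inj _ s)); apply: eq_card => j.
  by rewrite !inE !ffunE.
apply/forallP/forallP => [rank_s i | incr_g i].
  (* Every [a] is some [s i], so the rank of [g a] is [a] itself; since ranks are monotone in the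
     values, [g j <= g i] forces [j <= i]. *)
  have rank_g a : nat_of_ord a = #|[set b | (g b < g a)%N]|.
    by have /eqP := rank_s (s^-1%g a); rewrite card_s permKV.
  apply/forallP => j; apply/implyP; apply: contraTT.
  rewrite -!leqNgt => le_gji; rewrite (rank_g j) (rank_g i).
  by apply/subset_leq_card/subsetP => b; rewrite !inE => /leq_trans; apply.
have lt_g a b : (g b < g a)%N = (b < a)%N.
  apply/idP/idP; last by have /forallP/(_ a)/implyP := incr_g b.
  apply: contraTT; rewrite -!leqNgt leq_eqVlt => /predU1P[/val_inj->//|lt_ab].
  by apply: ltnW; have /forallP/(_ b)/implyP := incr_g a; apply.
rewrite card_s; apply/eqP.
transitivity (\sum_(b < n | (b < s i)%N) 1)%N.
  rewrite -(big_ord_widen n (fun=> 1%N)) ?sum_nat_const ?card_ord ?muln1 //.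
  by apply: ltnW.
by rewrite sum1_card; apply: eq_card => b; rewrite !inE lt_g.
Qed.

(** Distinct values have distinct ranks, all below [n], so the rank map is an injection of ['I_n]
    into itself, hence a permutation. *)
Lemma is_rank_unique (n p : nat) (f : {ffun 'I_n -> 'I_p}) :
  injective f -> exists s, is_rank f =1 pred1 s.
Proof.
move=> inj_f; pose r i := #|[set j | (f j < f i)%N]|.
have lt_r i j : (f i < f j)%N -> (r i < r j)%N.
  move=> lt_ij; apply/proper_card/properP; split.
    by apply/subsetP => k; rewrite !inE => /ltn_trans; apply.
  by exists i; rewrite inE // ltnn.
have lt_rn i : (r i < n)%N.
  rewrite -[X in (_ < X)%N](card_ord n) -cardsT; apply/proper_card/properP.
  by split; [exact: subsetT | exists i; rewrite !inE ?ltnn].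
have inj_r : injective (fun i => Ordinal (lt_rn i)).
  move=> i j /(congr1 val) /= eq_r; apply/inj_f/val_inj => /=.
  by case: (ltngtP (f i) (f j)) => // /lt_r; rewrite eq_r ltnn.
exists (perm inj_r) => s; apply/forallP/eqP => [rank_s | -> i].
  by apply/permP => i; apply/val_inj; rewrite permE /=; exact/eqP/rank_s.
by rewrite permE.
Qed.

(* A nonzero term of det_mulmx_sum has f injective, and such an f factors
   uniquely as g \o s with g increasing and s a permutation, namely the ranks
   of the values of f. *)
Lemma Cauchy_Binet (R : comPzRingType) (n p : nat)
    (A : 'M[R]_(n, p)) (B : 'M[R]_(p, n)) :
  \det (A *m B) =
    \sum_(g : {ffun 'I_n -> 'I_p} | increasing_ffun g)
      \det (colsub g A) * \det (rowsub g B).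
Proof.
rewrite det_mulmx_sum.
(* The inner sum has exactly one term when [f] is injective; otherwise [rowsub f B] has two equal
   rows and both sides vanish. *)
transitivity (\sum_(f : {ffun 'I_n -> 'I_p}) \sum_(s : 'S_n | is_rank f s)
    \prod_i A i (f i) * \det (rowsub f B)).
  apply: eq_bigr => f _; have [/is_rank_unique[s rank_f]|] := injectiveP f.
    by rewrite (big_pred1 s).
  move/injectiveP/injectivePn => [i [j neq_ij eq_fij]].
  rewrite [\det _](determinant_alternate neq_ij) ?mulr0 ?big1 // => l.
  by rewrite !mxE eq_fij.
rewrite (exchange_big_dep predT) //=.
transitivity (\sum_(s : 'S_n) \sum_(g : {ffun 'I_n -> 'I_p} | increasing_ffun g)
    ((-1) ^+ s * \prod_i colsub g A i (s i)) * \det (rowsub g B)).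
  apply: eq_bigr => s _.
  pose comp (t : 'S_n) (g : {ffun 'I_n -> 'I_p}) := [ffun i => g (t i)].
  have compK t : cancel (comp t) (comp t^-1%g).
    by move=> g; apply/ffunP => i; rewrite !ffunE permKV.
  (* For fixed [s], substitute [f = g \o s]; the rank condition on [f] then says that [g] is
     increasing. *)
  rewrite (reindex_inj (can_inj (compK s))) /=.
  apply: eq_big => [g | g _]; first exact: is_rank_comp.
  have -> : rowsub (comp s g) B = row_perm s (rowsub g B).
    by apply/matrixP => i j; rewrite !mxE ffunE.
  (* Undoing the row permutation of [B] yields the sign that completes a Leibniz term of
     [colsub g A]. *)
  rewrite row_permE det_mulmx det_perm mulrA [X in X * _]mulrC.
  by congr (_ * _ * _); apply: eq_bigr => i _; rewrite mxE ffunE.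
by rewrite exchange_big; apply: eq_bigr => g _; rewrite -mulr_suml.
Qed.

(** With sigma_3, ..., sigma_k fixed, the remaining indices depend on the row [i] alone, and the sum
    over sigma_2 is a Leibniz expansion. *)
Lemma hyperdet_det (R : comPzRingType) (n k : nat)
    (FF : {ffun 'I_(k - 2) -> 'S_n} -> R)
    (M : 'I_n -> 'I_n -> {ffun 'I_(k - 2) -> 'I_n} -> R) :
  hyperdet FF M =
    \sum_(s : {ffun 'I_(k - 2) -> 'S_n})
      FF s * \det (\matrix_(i, j) M i j [ffun l => s l i]).
Proof.
rewrite /hyperdet exchange_big; apply: eq_bigr => s _; rewrite mulr_sumr.
apply: eq_bigr => t _; rewrite mulrAC mulrC; congr (_ * (_ * _)).
by apply: eq_bigr => i _; rewrite mxE.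
Qed.

Lemma hyperdet_Cauchy_Binet (R : comPzRingType) (n p k : nat)
    (FF : {ffun 'I_(k - 2) -> 'S_n} -> R)
    (A : 'I_n -> 'I_p -> {ffun 'I_(k - 2) -> 'I_n} -> R)
    (B : 'M[R]_(p, n)) :
  hyperdet FF (fun i j u => \sum_l A i l u * B l j) =
    \sum_(g : {ffun 'I_n -> 'I_p} | increasing_ffun g)
      hyperdet FF (fun i j => A i (g j)) * \det (rowsub g B).
Proof.
rewrite hyperdet_det.
under [RHS]eq_bigr => g _ do rewrite hyperdet_det mulr_suml.
rewrite [RHS]exchange_big; apply: eq_bigr => s _.
pose As := \matrix_(i < n, l < p) A i l [ffun j => s j i].
have -> : \matrix_(i, j) (\sum_l A i l [ffun j => s j i] * B l j) = As *m B.
  by apply/matrixP => i j; rewrite !mxE; apply: eq_bigr => l _; rewrite mxE.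
(* [B] does not depend on [s], so its minor is a common factor of the sum over [s]. *)
rewrite Cauchy_Binet mulr_sumr; apply: eq_bigr => g _; rewrite mulrA.
by congr (_ * \det _ * _); apply/matrixP => i j; rewrite !mxE.
Qed.

Lemma eq_hyperdet (R : pzRingType) (n k : nat)
    (FF : {ffun 'I_(k - 2) -> 'S_n} -> R)
    (M N : 'I_n -> 'I_n -> {ffun 'I_(k - 2) -> 'I_n} -> R) :
  (forall i j u, M i j u = N i j u) -> hyperdet FF M = hyperdet FF N.
Proof.
move=> eqMN; apply: eq_bigr => t _; apply: eq_bigr => s _; congr (_ * _).
exact: eq_bigr.
Qed.

Theorem theorem3 (R : comPzRingType) (d : Order.disp_t)
  (L : finMeetSemilatticeType d) (n m : nat) (X Xbar : {set L})
  (x : 'I_(n + m) -> L) (x_inj : injective x)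
  (defX : X = [set x (lshift m i) | i : 'I_n])
  (defXbar : Xbar = [set x j | j : 'I_(n + m)])
  (Xbar_closure : smallest_factor_closed X Xbar)
  (z : L -> L) (hz : forall v : L, v \in X -> z v \in Xbar /\ (z v <= v)%O)
  (F f : L -> L -> R)
  (deff : forall v : L, v \in X -> forall y : L,
     f v y = \sum_(w : L | (w <= y)%O) mobius R w y * F v w)
  (k : nat) (hk : (2 <= k)%N) (FF : {ffun 'I_(k - 2) -> 'S_n} -> R) :
  hyperdet FF (fun i1 i2 i =>
    F (x (lshift m i1))
      (bigmeet (z (x (lshift m i1)) `&` x (lshift m i2))%O
               (fun j => x (lshift m (i j)))))
  = \sum_(kk : {ffun 'I_n -> 'I_(n + m)} |
            [forall i : 'I_n, forall j : 'I_n, (i < j)%N ==> (kk i < kk j)%N])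
      hyperdet FF (fun i1 i2 i =>
        f (x (lshift m i1)) (x (kk i2)) *
        zeta R (x (kk i2))
          (bigmeet (z (x (lshift m i1))) (fun j => x (lshift m (i j)))))
      * \det (\matrix_(i < n, j < n) zeta R (x (kk i)) (x (lshift m j))).
Proof.
have [closedXbar _ _] := Xbar_closure.
pose A i l (u : {ffun 'I_(k - 2) -> 'I_n}) := f (x (lshift m i)) (x l) *
  zeta R (x l) (bigmeet (z (x (lshift m i))) (fun j => x (lshift m (u j)))).
pose B := \matrix_(l < n + m, j < n) zeta R (x l) (x (lshift m j)).
transitivity (hyperdet FF (fun i j u => \sum_l A i l u * B l j)).
  apply: eq_hyperdet => i j u.
  have Xi : x (lshift m i) \in X by rewrite defX imset_f.
  set v := bigmeet _ _.
  (* Such a [y] lies below z_x, which belongs to the factor-closed set [Xbar]. *)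
  have Xbar_le y : (y <= v)%O -> y \in Xbar.
    rewrite le_bigmeet lexI -andbA => /andP[le_yz _].
    by apply: closedXbar le_yz; case: (hz _ Xi).
  rewrite -(mobius_inversion (F (x (lshift m i))) v).
  under eq_bigr => y _ do rewrite -deff //.
  (* The condition [y <= v] becomes a 0/1 factor, so that the range of summation no longer depends
     on [i], [j], [u] and can be indexed by ['I_(n + m)] through the injection [x]. *)
  transitivity (\sum_(y in Xbar)
      f (x (lshift m i)) y * ((y <= v)%O)%:R).
    rewrite big_mkcond [RHS]big_mkcond; apply: eq_bigr => y _.
    case: ifPn => [/Xbar_le->|_]; first by rewrite mulr1.
    by rewrite mulr0 if_same.
  rewrite defXbar big_imset /=; last by move=> a b _ _; apply: x_inj.
  apply: eq_bigr => l _; rewrite mxE /A /zeta -mulrA -natrM mulnb.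
  by rewrite /v le_bigmeetI.
rewrite hyperdet_Cauchy_Binet; apply: eq_bigr => g _; congr (_ * \det _).
by apply/matrixP => i j; rewrite !mxE.
Qed.
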